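(* For a bipartite state $\rho_{AB}$ acting on a separable Hilbert space, $E_\kappa(\rho_{AB})\ge0$, and $E_\kappa(\rho_{AB})=0$ if and only if $\rho_{AB}^{T_B}\ge0$.
   Context: A bipartite state $\rho_{AB}$ is a positive semi-definite operator of unit trace on $\mathcal{H}_A\otimes\mathcal{H}_B$. The partial transpose with respect to a fixed orthonormal basis $\{|i\rangle_B\}_i$ is the linear map $T_B(X_{AB})=X_{AB}^{T_B}:=\sum_{i,j}(I_A\otimes|i\rangle\langle j|_B)X_{AB}(I_A\otimes|i\rangle\langle j|_B)$. $\kappa$-entanglement: $E_\kappa(\rho_{AB}):=\inf\{\log_2\operatorname{Tr}[S_{AB}]: S_{AB}\ge0,\ -S_{AB}^{T_B}\le\rho_{AB}^{T_B}\le S_{AB}^{T_B}\}$, the infimum being over trace-class operators $S_{AB}$ (with value $+\infty$ if the feasible set is empty). *)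

(* Defs.v *)
From HB Require Import structures.
From mathcomp Require Import all_boot all_order all_algebra.
From mathcomp Require Import all_classical all_reals all_analysis.
From mathcomp Require Import summability complex.

Set Implicit Arguments.
Unset Strict Implicit.
Unset Printing Implicit Defensive.

Import Order.TTheory GRing.Theory Num.Theory.
Import numFieldNormedType.Exports.

Local Open Scope classical_set_scope.
Local Open Scope complex_scope.
Local Open Scope ring_scope.

(* Complex Hilbert spaces. [hdot] is linear in its first argument, so the Dirac
   bracket <x|y>, linear in y, is [hdot y x]. *)
HB.mixin Record isHilbert (R : realType) H of CompleteNormedModule R[i] H := {
  hdot : {dot H for (@Num.conj R[i])} ;
  hdot_norm : forall x : H, hdot x x = `|x| ^+ 2
}.

#[short(type="hilbertType")]
HB.structure Definition Hilbert (R : realType) :=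
  {H of isHilbert R H & CompleteNormedModule R[i] H}.

Notation "<| x , y |>" := (hdot y x)
  (at level 0, x at level 99, y at level 99, format "<| x ,  y |>") : ring_scope.

Definition separable_space (T : topologicalType) : Prop :=
  exists2 D : set T, countable D & dense D.

(* Convergence of the net of finite partial sums. *)
Definition has_sum (R : realType) (I : choiceType) (V : normedModType R[i])
    (x : I -> V) (s : V) : Prop :=
  partial_sum x @ totally --> s.

Definition linear_span (R : realType) (V : lmodType R[i]) (A : set V) : set V :=
  [set x | exists n (c : 'I_n -> R[i]) (v : 'I_n -> V),
     (forall k, A (v k)) /\ x = \sum_(k < n) c k *: v k].

Section HilbertSpace.
Context {R : realType}.
Implicit Types (H : hilbertType R).

Definition orthonormal_basis H (I : choiceType) (e : I -> H) : Prop :=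
  (forall i j, <| e i, e j |> = (i == j)%:R) /\
  dense (linear_span (range e)).

(* Positive semi-definiteness. The order of [R[i]] is partial: [0 <= z] says
   that [z] is real and nonnegative. *)
Definition psd H (T : H -> H) : Prop := forall x, 0 <= <| x, T x |>.

Definition op_le H (T U : H -> H) : Prop := psd (fun x => U x - T x).

(* [t] is the value of the trace of [T], computed in any orthonormal basis. *)
Definition has_trace H (T : H -> H) (t : R[i]) : Prop :=
  forall (I : choiceType) (e : I -> H), orthonormal_basis e ->
    has_sum (fun i => <| e i, T (e i) |> : R[i]^o) t.

(* [P] is the absolute value |T|: the positive bounded operator whose square is
   T^* T. *)
Definition is_abs_op H (T P : {linear H -> H}) : Prop :=
  [/\ continuous P, psd P &
      forall x y, <| x, P (P y) |> = <| T x, T y |>].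

Definition trace_class H (T : {linear H -> H}) : Prop :=
  continuous T /\ exists P : {linear H -> H}, is_abs_op T P /\
    exists t, has_trace P t.

Definition density_op H (T : {linear H -> H}) : Prop :=
  [/\ trace_class T, psd T & has_trace T 1].

(* The operator |x><y|. *)
Definition ketbra H (x y : H) : H -> H := fun z => <| y, z |> *: x.

End HilbertSpace.

Section Bipartite.
Context {R : realType} {HA HB HAB : hilbertType R}.

(* [HAB], with the elementary tensors [tens a b], is the Hilbert space tensor
   product of [HA] and [HB]; this determines it up to a unique unitary. *)
Definition is_tensor_product (tens : HA -> HB -> HAB) : Prop :=
  [/\ forall b, linear (tens^~ b),
      forall a, linear (tens a),
      forall a a' b b',
        <| tens a b, tens a' b' |> = <| a, a' |> * <| b, b' |> &
      dense (linear_span [set x | exists a b, x = tens a b])].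

Variable tens : HA -> HB -> HAB.

Definition is_tensor_op (S : HA -> HA) (T : HB -> HB)
    (U : {linear HAB -> HAB}) : Prop :=
  continuous U /\ forall a b, U (tens a b) = tens (S a) (T b).

Variables (J : choiceType) (f : J -> HB).

(* [Y] is the partial transpose of [X] in the basis [f]:
     Y = \sum_(i, j) (I (x) |i><j|) X (I (x) |i><j|),
   a double sum which for infinite [J] is taken in the strong operator
   topology. It converges for every trace-class [X] (even in Hilbert-Schmidt
   norm), but [Y] is in general only bounded, not trace-class. *)
Definition is_partial_transpose (X Y : {linear HAB -> HAB}) : Prop :=
  continuous Y /\
  exists E : J -> J -> {linear HAB -> HAB},
    (forall i j, is_tensor_op idfun (ketbra (f i) (f j)) (E i j)) /\
    forall x, has_sum (fun ij : J * J => E ij.1 ij.2 (X (E ij.1 ij.2 x))) (Y x).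

Definition kappa_feasible (rho S : {linear HAB -> HAB}) : Prop :=
  [/\ trace_class S, psd S &
      exists rhoT ST : {linear HAB -> HAB},
        [/\ is_partial_transpose rho rhoT, is_partial_transpose S ST,
            op_le (fun x => - ST x) rhoT & op_le rhoT ST]].

Definition log2 (t : \bar R) : \bar R := (lne t * ((ln 2)^-1)%:E)%E.

Definition kappa_entanglement (rho : {linear HAB -> HAB}) : \bar R :=
  ereal_inf [set z | exists S (t : R),
    [/\ kappa_feasible rho S, has_trace S t%:C & z = log2 t%:E]].

Definition ppt (rho : {linear HAB -> HAB}) : Prop :=
  exists2 rhoT : {linear HAB -> HAB}, is_partial_transpose rho rhoT & psd rhoT.

End Bipartite.

(* Main.v *)
(** The partial transpose does not change the diagonal entries in a product
basis [e_i (x) f_j]. So if [S] is feasible, [D = S^T - rho^T] is positive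
with diagonal entries summing to [Tr S - 1]; hence [Tr S >= 1], and every
diagonal entry of [D] is at most [Tr S - 1]. By the parallelogram law
[<x, D x> <= C_x (Tr S - 1)] for each [x] in the span of the product basis, so
[0 <= <x, S^T x> <= <x, rho^T x> + C_x (Tr S - 1)]. When the infimum is [0] the
traces come arbitrarily close to [1], and [rho^T >= 0] follows by density.
Conversely, if [rho^T >= 0] then [S = rho] is feasible. *)

Require Import Defs.
From HB Require Import structures.
From mathcomp Require Import all_boot all_order all_algebra.
From mathcomp Require Import all_classical all_reals all_analysis.
From mathcomp Require Import finmap summability complex ring lra.

Set Implicit Arguments.
Unset Strict Implicit.
Unset Printing Implicit Defensive.

Import Order.TTheory GRing.Theory Num.Theory.
Import numFieldNormedType.Exports.

Local Open Scope classical_set_scope.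
Local Open Scope ring_scope.

(** * Inner product: sesquilinearity, polarization, continuity *)

Section DotProduct.
Variables (R : realType) (H : hilbertType R).
Implicit Types (x y z : H) (a : R[i]).

Lemma hdotDr x y z : <| x, y + z |> = <| x, y |> + <| x, z |>.
Proof. exact: linearDl. Qed.

Lemma hdotBr x y z : <| x, y - z |> = <| x, y |> - <| x, z |>.
Proof. exact: linearBl. Qed.

Lemma hdotZr a x y : <| x, a *: y |> = a * <| x, y |>.
Proof. exact: linearZl_LR. Qed.

Lemma hdot0r x : <| x, 0 |> = 0.
Proof. exact: linear0l. Qed.

Lemma hdotDl x y z : <| y + z, x |> = <| y, x |> + <| z, x |>.
Proof. exact: linearDr. Qed.

Lemma hdotBl x y z : <| y - z, x |> = <| y, x |> - <| z, x |>.
Proof. exact: linearBr. Qed.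

Lemma hdotZl a x y : <| a *: y, x |> = a^* * <| y, x |>.
Proof. exact: linearZr_LR. Qed.

Lemma hdotC x y : <| y, x |> = <| x, y |>^*.
Proof. by rewrite hermC /= expr0 mul1r. Qed.

(** Expresses the inner product through norms alone, so that its continuity follows from that of the
    norm. *)
Lemma hdot_polarization x y :
  <| x, y |> *+ 4 =
    (`|x + y| ^+ 2 - `|x - y| ^+ 2)
    - 'i * (`|x + 'i *: y| ^+ 2 - `|x - 'i *: y| ^+ 2).
Proof.
(* The expansion for a unimodular [c], to be used at [1], [-1], ['i] and [- 'i]. *)
have E (c : R[i]) : c * c^* = 1 ->
    `|x + c *: y| ^+ 2 =
    `|x| ^+ 2 + `|y| ^+ 2 + (c * <| x, y |> + c^* * <| y, x |>).
  move=> c1; rewrite -!hdot_norm hdotDl !hdotDr !hdotZl !hdotZr.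
  by rewrite (mulrCA c^*) mulrA c1 mul1r; ring.
have i2 : 'i * 'i = -1 :> R[i] by rewrite -expr2 sqrCi.
have ci : ('i : R[i])^* = - 'i := conjCi _.
have := E 1; rewrite scale1r rmorph1 mulr1 => /(_ erefl) ->.
have := E (-1); rewrite scaleN1r rmorphN rmorph1 mulrNN mulr1 => /(_ erefl) ->.
have := E 'i; rewrite ci mulrN i2 opprK => /(_ erefl) ->.
have := E (- 'i); rewrite scaleNr rmorphN /= ci opprK mulNr i2 opprK.
move=> /(_ erefl) ->.
set u := _ + `|y| ^+ 2; set v := <| x, y |>; set w := <| y, x |>.
have -> : (u + (1 * v + 1 * w) - (u + (- 1 * v + - 1 * w)))
    - 'i * (u + ('i * v + - 'i * w) - (u + (- 'i * v + 'i * w)))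
  = v *+ 2 + w *+ 2 - ('i * 'i) * (v *+ 2 - w *+ 2) by ring.
by rewrite i2; ring.
Qed.

Lemma continuous_hdot (T : topologicalType) (f g : T -> H) :
  continuous f -> continuous g ->
  continuous (fun t => <| f t, g t |> : R[i]^o).
Proof.
move=> cf cg.
have sq (h : T -> H) : continuous h ->
    continuous (fun t => `|h t| ^+ 2 : R[i]^o).
  move=> ch t; apply: cvgM; apply: cvg_norm; exact: ch.
have -> : (fun t => <| f t, g t |> : R[i]^o) = (fun t =>
    4^-1 * ((`|f t + g t| ^+ 2 - `|f t - g t| ^+ 2)
    - 'i * (`|f t + 'i *: g t| ^+ 2 - `|f t - 'i *: g t| ^+ 2)) : R[i]^o).
  apply/funext => t; rewrite -hdot_polarization.
  by rewrite -(mulr_natl <| f t, g t |>) mulKf ?pnatr_eq0.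
move=> t; apply: cvgM; first exact: cvg_cst.
apply: cvgB; [|apply: cvgM; first exact: cvg_cst];
  (apply: cvgB; apply: sq => {}t).
- by apply: cvgD; [exact: cf | exact: cg].
- by apply: cvgB; [exact: cf | exact: cg].
- by apply: cvgD; [exact: cf | apply: cvgZr; exact: cg].
- by apply: cvgB; [exact: cf | apply: cvgZr; exact: cg].
Qed.

End DotProduct.

(** * Closed sets, dense spans and extension by density *)

Lemma closed_preimage_eq (K : numFieldType) (T : topologicalType)
    (V : normedModType K) (f g : T -> V) :
  continuous f -> continuous g -> closed [set x | f x = g x].
Proof.
move=> cf cg.
have -> : [set x | f x = g x] = (fun x => f x - g x) @^-1` [set 0].
  by apply/seteqP; split=> x /=; [move->; rewrite subrr | exact: subr0_eq].
apply: preimage_closed.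
  by move=> x _; apply: cvgB; [exact: cf | exact: cg].
exact/accessible_closed_set1/hausdorff_accessible/norm_hausdorff.
Qed.

(** The order may be partial, as on [R[i]]; [a <= z] amounts to [|z - a| = z - a], an equality of
    continuous functions. *)
Lemma closed_num_ge (K : numFieldType) (a : K) : closed [set z : K^o | a <= z].
Proof.
have -> : [set z : K^o | a <= z] = [set z : K^o | `|z - a| = z - a].
  by apply/seteqP; split=> z /=; rewrite -(subr_ge0 a) ger0_def => /eqP.
have cB : continuous (fun z : K^o => z - a).
  by move=> z; exact: (cvgB (@cvg_id _ (nbhs z)) (cvg_cst a)).
apply: (@closed_preimage_eq K K^o K^o (fun z => `|z - a|) _) => //.
by move=> z; exact: (cvg_norm (cB z)).
Qed.

Section Closed.
Variable R : realType.

Lemma dense_sub_closed (T : topologicalType) (D C : set T) :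
  dense D -> closed C -> D `<=` C -> forall x, C x.
Proof.
move=> dD cC DC x; apply: contrapT => nCx.
have [||y [/= nCy Dy]] := dD (~` C); [by exists x | exact: closed_openC |].
exact/nCy/DC.
Qed.

(** The induction principle behind the density arguments: a closed linear condition only has to be
    checked on generators. *)
Lemma dense_span_closed (V : normedModType R[i]) (A C : set V) :
  dense (linear_span A) -> closed C -> C 0 ->
  (forall a x y, C x -> C y -> C (a *: x + y)) ->
  A `<=` C -> forall x, C x.
Proof.
move=> dA cC C0 CP AC; apply: dense_sub_closed dA cC _.
move=> _ [n [c [v [Av ->]]]].
elim/big_rec: _ => // k x _ Cx; exact/CP/Cx/AC/Av.
Qed.

Lemma linear_span0 (V : lmodType R[i]) (A : set V) : linear_span A 0.
Proof.
by exists 0%N, (fun=> 0), (fun=> 0); split; [case | rewrite big_ord0].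
Qed.

Lemma linear_spanP (V : lmodType R[i]) (A : set V) a x y :
  linear_span A x -> linear_span A y -> linear_span A (a *: x + y).
Proof.
move=> [m [c [v [Av ->]]]] [n [d [w [Aw ->]]]].
exists (m + n)%N,
  (fun k => match fintype.split k with inl i => a * c i | inr j => d j end),
  (fun k => match fintype.split k with inl i => v i | inr j => w j end).
split; first by move=> k; case: fintype.split.
rewrite big_split_ord /= scaler_sumr; congr (_ + _); apply: eq_bigr => i _.
  by rewrite (unsplitK (inl i)) scalerA.
by rewrite (unsplitK (inr i)).
Qed.

Lemma mem_linear_span (V : lmodType R[i]) (A : set V) : A `<=` linear_span A.
Proof.
move=> x Ax; exists 1%N, (fun=> 1), (fun=> x); split=> //.
by rewrite big_ord1 scale1r.
Qed.

Lemma closure_spanP (V : normedModType R[i]) (A : set V) a x y :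
  closure (linear_span A) x -> closure (linear_span A) y ->
  closure (linear_span A) (a *: x + y).
Proof.
move=> clx cly U nU.
have cP : (fun z : V * V => a *: z.1 + z.2) @ (x, y) --> a *: x + y.
  by apply: cvgD; [apply: cvgZr; exact: cvg_fst | exact: cvg_snd].
have [[P Q] /= [nP nQ] PQ] := cP _ nU.
have [u [Au Pu]] := clx _ nP; have [v [Av Qv]] := cly _ nQ.
by exists (a *: u + v); split; [exact: linear_spanP | exact: (PQ (u, v))].
Qed.

Lemma dense_closure (T : topologicalType) (D : set T) :
  (forall x, closure D x) -> dense D.
Proof.
move=> clD O [x Ox] oO; rewrite setIC; apply: (clD x).
by apply: open_nbhs_nbhs; split.
Qed.

Lemma eq_on_dense_span (V W : normedModType R[i]) (f g : {linear V -> W})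
    (A : set V) :
  continuous f -> continuous g -> dense (linear_span A) ->
  (forall x, A x -> f x = g x) -> forall x, f x = g x.
Proof.
move=> cf cg dA fg.
apply: (dense_span_closed dA (C := [set x | f x = g x])) => //.
- exact: closed_preimage_eq.
- by rewrite /= !linear0.
- by move=> a x y /= fgx fgy; rewrite !linearP fgx fgy.
Qed.

End Closed.

(** * Unconditional sums *)

Section HasSum.
Variables (R : realType) (I : choiceType).

Lemma has_sum_unique (V : normedModType R[i]) (x : I -> V) s t :
  has_sum x s -> has_sum x t -> s = t.
Proof.
move=> xs xt; have FF := @totally_filter I.
exact: (cvg_unique (@norm_hausdorff _ V) xs xt).
Qed.

Lemma has_sumB (V : normedModType R[i]) (x y : I -> V) s t :
  has_sum x s -> has_sum y t -> has_sum (fun i => x i - y i) (s - t).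
Proof.
move=> xs yt; have FF := @totally_filter I.
rewrite /has_sum.
have -> : partial_sum (fun i => x i - y i) = partial_sum x - partial_sum y.
  by apply/funext => A; exact: sumrB.
exact: cvgB.
Qed.

Lemma has_sum_linear (V W : normedModType R[i]) (f : {linear V -> W})
    (x : I -> V) s :
  continuous f -> has_sum x s -> has_sum (f \o x) (f s).
Proof.
move=> cf xs; have FF := @totally_filter I.
rewrite /has_sum; have -> : partial_sum (f \o x) = f \o partial_sum x.
  by apply/funext => A; rewrite /partial_sum /= linear_sum.
exact: (cvg_comp _ _ xs (cf s)).
Qed.

Lemma has_sum1 (V : normedModType R[i]) (i : I) (x : I -> V) :
  (forall j, j != i -> x j = 0) -> has_sum x (x i).
Proof.
move=> x0; have FF := @totally_filter I.
apply: cvg_near_cst; exists [fset i]%fset => // A /= iA.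
have iA' : i \in A by rewrite (fsubsetP iA) ?inE.
rewrite /partial_sum (bigD1 [` iA']%fset) //= big1 ?addr0 // => j ji.
by apply: x0; apply: contra ji => /eqP ji; apply/eqP/val_inj.
Qed.

(** Every partial sum over a finite set containing [A] dominates the one over [A], and a closed
    half-line keeps this bound in the limit. *)
Lemma has_sum_ge (x : I -> R[i]^o) s (A : {fset I}) :
  (forall i, 0 <= x i) -> has_sum x s -> \sum_(i : A) x (val i) <= s.
Proof.
move=> x0 xs; have FF := @totally_filter I.
apply: (closed_cvg _ (@closed_num_ge R[i] _) _ _ xs).
exists A => // B /= AB; rewrite /partial_sum.
rewrite -!(big_seq_fsetE _ _ xpredT x) /= (big_fsetID _ (mem A) B) /=.
have -> : [fset i in B | i \in A]%fset = A.
  by apply/fsetP => i; rewrite !inE /= andb_idl // => /(fsubsetP AB).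
by rewrite lerDl sumr_ge0.
Qed.

End HasSum.

(** * Tensor products, product bases and the partial transpose *)

Lemma lipschitz_continuous (K : numFieldType) (V W : normedModType K)
    (g : V -> W) (C : K) : 0 <= C ->
  (forall x y, `|g x - g y| <= C * `|x - y|) -> continuous g.
Proof.
move=> C0 gC x; apply/cvgrPdist_lt => e e0.
(* [C] may vanish, so the division is by [C + 1]. *)
have C1 : 0 < C + 1 by rewrite ltr_wpDl.
near=> y; apply: (le_lt_trans (gC x y)).
apply: (@le_lt_trans _ _ ((C + 1) * `|x - y|)).
  by rewrite ler_wpM2r // lerDl.
rewrite -ltr_pdivlMl // mulrC; near: y.
by apply: cvgr_dist_lt; rewrite ?divr_gt0.
Unshelve. all: by end_near. Qed.

Section TensorProduct.
Context {R : realType} {HA HB HAB : hilbertType R}.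
Variables (tens : HA -> HB -> HAB) (tensP : is_tensor_product tens).

Lemma tens_linearl b : linear (tens^~ b).
Proof. by case: tensP. Qed.

Lemma tens_linearr a : linear (tens a).
Proof. by case: tensP. Qed.

Lemma hdot_tens a a' b b' :
  <| tens a b, tens a' b' |> = <| a, a' |> * <| b, b' |>.
Proof. by case: tensP. Qed.

Lemma tens0r a : tens a 0 = 0.
Proof.
by have := tens_linearr a (-1) 0 0; rewrite scaler0 addr0 scaleN1r addNr.
Qed.

Lemma tens0l b : tens 0 b = 0.
Proof.
by have := tens_linearl b (-1) 0 0; rewrite /= scaler0 addr0 scaleN1r addNr.
Qed.

Lemma tensZr c a b : tens a (c *: b) = c *: tens a b.
Proof. by have := tens_linearr a c b 0; rewrite tens0r !addr0. Qed.

Lemma tensBr a b b' : tens a (b - b') = tens a b - tens a b'.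
Proof.
by have := tens_linearr a (-1) b' b; rewrite !scaleN1r ![- _ + _]addrC.
Qed.

Lemma tensBl a a' b : tens (a - a') b = tens a b - tens a' b.
Proof.
by have := tens_linearl b (-1) a' a; rewrite /= !scaleN1r ![- _ + _]addrC.
Qed.

Lemma norm_tens a b : `|tens a b| = `|a| * `|b|.
Proof.
apply/eqP; rewrite -(eqrXn2 (n := 2)) ?mulr_ge0 //; apply/eqP.
by rewrite exprMn -!hdot_norm hdot_tens.
Qed.

Lemma continuous_tensr a : continuous (tens a).
Proof.
apply: (@lipschitz_continuous _ _ _ _ `|a|) => // b b'.
by rewrite -tensBr norm_tens.
Qed.

Lemma continuous_tensl b : continuous (tens^~ b).
Proof.
apply: (@lipschitz_continuous _ _ _ _ `|b|) => // a a'.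
by rewrite -tensBl norm_tens mulrC.
Qed.

Lemma dense_tens : dense (linear_span [set x | exists a b, x = tens a b]).
Proof. by case: tensP. Qed.

Section Basis.
Variables (J : choiceType) (f : J -> HB) (fB : orthonormal_basis f).

Lemma orthonormal_basis_dot i j : <| f i, f j |> = (i == j)%:R.
Proof. by case: fB. Qed.

(** Density is used twice: elementary tensors generate [HAB], and for fixed [a] the second factor is
    approximated in the span of [f]. *)
Lemma tens_basis_closed (C : set HAB) :
  closed C -> C 0 -> (forall c x y, C x -> C y -> C (c *: x + y)) ->
  (forall a j, C (tens a (f j))) -> forall x, C x.
Proof.
move=> cC C0 CP Cf.
apply: (dense_span_closed dense_tens) => // _ [a [b ->]]; move: b.
have [_ df] := fB.
apply: (dense_span_closed df (C := tens a @^-1` C)).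
- by apply: preimage_closed => // b _; exact: continuous_tensr.
- by rewrite /= tens0r.
- by move=> c b b' Cb Cb'; rewrite /= tens_linearr; exact: CP.
- by move=> _ [j _ <-]; exact: Cf.
Qed.

(** Density of the span of [e] is asked under [J] so that an empty [J] is covered: the product
    family is then empty, whatever [e] is. *)
Lemma orthonormal_basis_tens (I : choiceType) (e : I -> HA) :
  (forall i i', <| e i, e i' |> = (i == i')%:R) ->
  (J -> dense (linear_span (range e))) ->
  orthonormal_basis (fun p : I * J => tens (e p.1) (f p.2)).
Proof.
move=> eo ed; split.
  move=> [i j] [i' j']; rewrite hdot_tens eo orthonormal_basis_dot -natrM mulnb.
  by rewrite -pair_eqE.
set g := fun p : I * J => _.
have cl0 : closure (linear_span (range g)) 0.
  exact/subset_closure/linear_span0.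
apply: dense_closure; apply: tens_basis_closed => //.
- exact: closed_closure.
- by move=> c x y; exact: closure_spanP.
move=> a j; move: a; apply: (dense_span_closed (ed j) 
  (C := tens^~ (f j) @^-1` closure (linear_span (range g)))).
- apply: preimage_closed; last exact: closed_closure.
  by move=> b _; exact: continuous_tensl.
- by rewrite /= tens0l.
- by move=> c a a' Ca Ca'; rewrite /= tens_linearl; exact: closure_spanP.
- move=> _ [i _ <-]; apply/subset_closure/mem_linear_span.
  by exists (i, j).
Qed.

(** This is the action of the adjoint of [I (x) |f_i><f_j|] on [a (x) f_k]. Both sides are linear
    and continuous in [y], so elementary tensors suffice. *)
Lemma hdot_tensor_unit i j (E : {linear HAB -> HAB}) a k y :
  is_tensor_op tens idfun (ketbra (f i) (f j)) E ->
  <| tens a (f k), E y |> = (k == i)%:R * <| tens a (f j), y |>.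
Proof.
move=> [cE Et]; move: y.
have ck b : continuous ((fun=> tens a b) : HAB -> HAB).
  by move=> ?; exact: cvg_cst.
apply: (dense_span_closed dense_tens
  (C := [set y | <| tens a (f k), E y |>
                 = (k == i)%:R * <| tens a (f j), y |>])).
- apply: (@closed_preimage_eq _ _ R[i]^o (fun y => <| tens a (f k), E y |>)
    (fun y => (k == i)%:R * <| tens a (f j), y |>)).
    exact: continuous_hdot.
  move=> y; apply: cvgM; first exact: cvg_cst.
  by apply: continuous_hdot => // ?; exact: cvg_id.
- by rewrite /= linear0 !hdot0r mulr0.
- move=> c x y /= Ex Ey.
  by rewrite linearP !hdotDr !hdotZr Ex Ey mulrDr mulrCA.
- move=> _ [a' [b' ->]] /=; rewrite Et /ketbra tensZr hdotZr !hdot_tens.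
  by rewrite orthonormal_basis_dot; ring.
Qed.

(** With [g = a (x) f_k], the right factor [E i j] kills [g] unless [j = k], and the left one is
    orthogonal to [g] unless [i = k]. Only the term [(k, k)] of the double sum survives. *)
Lemma partial_transpose_diag (X Y : {linear HAB -> HAB}) a k :
  is_partial_transpose tens f X Y ->
  <| tens a (f k), Y (tens a (f k)) |> = <| tens a (f k), X (tens a (f k)) |>.
Proof.
move=> [_ [E [Et XY]]].
have Es i j := hdot_tensor_unit _ _ _ (Et i j).
set g := tens a (f k).
have phi_lin : linear (fun y => <| g, y |> : R[i]^o).
  by move=> c x y; rewrite hdotDr hdotZr.
(* Bundled as a continuous linear form, pairing with [g] can be pushed through the sum defining
   [Y]. *)
pose phi : {linear HAB -> R[i]^o} :=
  HB.pack (fun y => <| g, y |> : R[i]^o)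
    (GRing.isLinear.Build _ _ _ _ _ phi_lin).
have cphi : continuous phi.
  by apply: continuous_hdot => ?; [exact: cvg_cst | exact: cvg_id].
have Eg i j : E i j g = (j == k)%:R *: tens a (f i).
  by case: (Et i j) => _ ->; rewrite /ketbra tensZr orthonormal_basis_dot.
have := has_sum_linear cphi (XY g); move/has_sum_unique; apply.
suff -> : <| g, X g |>
    = (phi \o (fun ij => E ij.1 ij.2 (X (E ij.1 ij.2 g)))) (k, k).
  apply: has_sum1 => -[i j]; rewrite -pair_eqE /= Es Eg.
  case: (eqVneq j k) => [-> | _]; last by rewrite scale0r linear0 hdot0r mulr0.
  by rewrite andbT eq_sym => /negbTE->; rewrite mul0r.
by rewrite /= Es Eg eqxx scale1r mul1r.
Qed.

(** The operators [E i j] are fixed by their values on elementary tensors, so both sums have the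
    same terms. This identifies the transposes of [rho] that come with different feasible [S]. *)
Lemma partial_transpose_unique (X Y Y' : {linear HAB -> HAB}) :
  is_partial_transpose tens f X Y -> is_partial_transpose tens f X Y' ->
  forall x, Y x = Y' x.
Proof.
move=> [_ [E [Et XY]]] [_ [E' [Et' XY']]] x.
have EE i j y : E i j y = E' i j y.
  move: y; apply: eq_on_dense_span dense_tens _;
    [exact: (Et i j).1 | exact: (Et' i j).1 |].
  by move=> _ [a [b ->]]; rewrite (Et i j).2 (Et' i j).2.
apply: has_sum_unique (XY x) _.
under eq_fun do rewrite !EE.
exact: XY'.
Qed.

End Basis.
End TensorProduct.

(** * Orthonormal bases of separable spaces by Gram-Schmidt *)

(** Indices that [g] does not reach on [D] get the default [point]; hence an inclusion only, which
    also allows [D] to be finite or empty. *)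
Lemma countable_enum (T : pointedType) (D : set T) :
  countable D -> exists u : nat -> T, D `<=` range u.
Proof.
move=> /countable_injP[g inj].
exists (fun n => xget point [set x | D x /\ g x = n]).
move=> x Dx; exists (g x) => //; case: xgetP => [y _ [Dy]|/(_ x)].
    by move=> gyx; apply: inj gyx; exact: mem_set.
by case.
Qed.

Lemma dense_subset (T : topologicalType) (A B : set T) :
  A `<=` B -> dense A -> dense B.
Proof.
by move=> AB dA O O0 oO; have [x [Ox /AB Bx]] := dA O O0 oO; exists x.
Qed.

Section GramSchmidt.
Variables (R : realType) (H : hilbertType R).
Implicit Types (w : seq H) (v : H).

Definition orthonormal_seq w : Prop :=
  uniq w /\ {in w &, forall x y, <| x, y |> = (x == y)%:R}.

(** For orthonormal [w], the component of [v] orthogonal to the span of [w]. *)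
Definition gram_schmidt_residue w v := v - \sum_(e <- w) <| e, v |> *: e.

Definition gram_schmidt_step w v :=
  let r := gram_schmidt_residue w v in
  if r == 0 then w else `|r|^-1 *: r :: w.

Lemma gram_schmidt_residue_orthogonal w v x :
  orthonormal_seq w -> x \in w -> <| x, gram_schmidt_residue w v |> = 0.
Proof.
move=> [uw ow] xw; rewrite hdotBr.
have -> : <| x, \sum_(e <- w) <| e, v |> *: e |>
    = \sum_(e <- w) <| e, v |> * <| x, e |>.
  by elim/big_rec2: _ => [|e y z _ <-]; rewrite ?hdot0r // hdotDr hdotZr.
rewrite (bigD1_seq x) //= big_seq_cond big1 ?addr0.
  by rewrite (ow x x) // eqxx mulr1 subrr.
by move=> e /andP[ew ex]; rewrite (ow x e) // eq_sym (negbTE ex) mulr0.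
Qed.

Lemma orthonormal_seq_step w v :
  orthonormal_seq w -> orthonormal_seq (gram_schmidt_step w v).
Proof.
move=> owu; have [uw ow] := owu; rewrite /gram_schmidt_step.
case: eqVneq => // r0; set r := gram_schmidt_residue w v in r0 *.
set e := `|r|^-1 *: r.
have xe x : x \in w -> <| x, e |> = 0.
  by move=> xw; rewrite hdotZr gram_schmidt_residue_orthogonal // mulr0.
have ex x : x \in w -> <| e, x |> = 0 by move=> xw; rewrite hdotC xe // rmorph0.
have ee : <| e, e |> = 1.
  by rewrite hdot_norm normrZ normfV normr_id mulVf ?expr1n // normr_eq0.
have ew : e \notin w.
  by apply/negP => /xe /eqP; rewrite ee oner_eq0.
split; first by rewrite /= ew.
move=> x y; rewrite !inE => /predU1P[->|xw] /predU1P[->|yw].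
- by rewrite ee eqxx.
- by rewrite ex //; case: eqVneq => // ey; rewrite ey yw in ew.
- by rewrite xe //; case: eqVneq => // ey; rewrite -ey xw in ew.
- exact: ow.
Qed.

Lemma gram_schmidt_step_subset w v : {subset w <= gram_schmidt_step w v}.
Proof.
by move=> x xw; rewrite /gram_schmidt_step; case: ifP; rewrite ?inE ?xw ?orbT.
Qed.

Lemma gram_schmidt_step_span w v :
  linear_span [set` gram_schmidt_step w v] v.
Proof.
(* Splits [v] into residue and projection; the residue is either zero or a multiple of the newly
   added vector. *)
suff : linear_span [set` gram_schmidt_step w v]
    (1 *: gram_schmidt_residue w v + \sum_(e <- w) <| e, v |> *: e).
  by rewrite scale1r subrK.
apply: linear_spanP; last first.
  rewrite big_seq_cond; elim/big_rec: _ => [|e x]; first exact: linear_span0.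
  rewrite andbT => ew Ax; apply: linear_spanP Ax; apply: mem_linear_span.
  exact: gram_schmidt_step_subset ew.
rewrite /gram_schmidt_step; case: eqVneq => [->|r0]; first exact: linear_span0.
set r := gram_schmidt_residue w v in r0 *.
suff : linear_span [set` `|r|^-1 *: r :: w] (`|r| *: (`|r|^-1 *: r) + 0).
  by rewrite addr0 scalerA mulfV ?scale1r // normr_eq0.
apply: linear_spanP (linear_span0 _).
by apply: mem_linear_span; rewrite /= mem_head.
Qed.

Fixpoint gram_schmidt (u : nat -> H) n : seq H :=
  if n is n'.+1 then gram_schmidt_step (gram_schmidt u n') (u n') else [::].

Lemma orthonormal_gram_schmidt u n : orthonormal_seq (gram_schmidt u n).
Proof. by elim: n => //= n; exact: orthonormal_seq_step. Qed.

Lemma gram_schmidt_subset u m n :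
  (m <= n)%N -> {subset gram_schmidt u m <= gram_schmidt u n}.
Proof.
move=> /subnK <-; elim: (n - m)%N => // k IH x /IH.
exact: gram_schmidt_step_subset.
Qed.

(** The stages of Gram-Schmidt are nested, so the vectors occurring at some stage form a basis,
    indexed by itself: any two share a stage, and stage [n.+1] spans [u n]. *)
Lemma separable_orthonormal_basis : separable_space H ->
  exists (I : choiceType) (e : I -> H), orthonormal_basis e.
Proof.
move=> [D /countable_enum[u Du] dD].
pose P x := `[< exists n, x \in gram_schmidt u n >].
exists {x : H | P x}, val; split.
  move=> x y; have /asboolP[m xm] := valP x; have /asboolP[n yn] := valP y.
  have [_ -> //] := orthonormal_gram_schmidt u (maxn m n).
  - exact: gram_schmidt_subset (leq_maxl _ _) _ xm.
  - exact: gram_schmidt_subset (leq_maxr _ _) _ yn.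
apply: dense_subset dD => x /Du[n _ <-].
have [k [c [v [vn ->]]]] := gram_schmidt_step_span (gram_schmidt u n) (u n).
exists k, c, v; split=> // i.
have Pv : P (v i) by apply/asboolP; exists n.+1; exact: vn.
by exists (exist _ (v i) Pv).
Qed.

End GramSchmidt.

(** Transfers separability from [HAB] to [HA]. The points of [D] need not lie in the image of [L],
    so nearby image points are chosen instead. *)
Lemma separable_isometry (R : realType) (V W : normedModType R[i])
    (L : V -> W) :
  (forall x y, `|L x - L y| = `|x - y|) ->
  separable_space W -> separable_space V.
Proof.
move=> isoL [D cD dD].
(* A point whose image is within [1/(n+1)] of the given point of [D], or [0] if there is none. *)
pose u (p : W * nat) := xget 0 [set x | `|p.1 - L x| < p.2.+1%:R^-1].
exists (u @` (D `*` setT)).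
  apply: sub_countable (card_image_le _ _) (countableX cD _).
  exact: countableP.
move=> O [x Ox] oO.
have /nbhs_ballP[e e0 xeO] : nbhs x O by apply: open_nbhs_nbhs; split.
(* The factor [2] pays for two triangle-inequality legs, from [L x] to [y] and from [y] to the image
   of the chosen point. *)
have [n ne] : exists n, 2 * n.+1%:R^-1 < e.
  have eR : (complex.Re e)%:C%C = e by apply: RRe_real; exact: gtr0_real.
  have r0 : 0 < complex.Re e by rewrite -ltcR eR.
  exists (Num.trunc (2 / complex.Re e)).
  have : 2 < complex.Re e * (Num.trunc (2 / complex.Re e)).+1%:R.
    by rewrite -ltr_pdivrMl // mulrC truncnS_gt.
  by rewrite -ltcR rmorphM !rmorph_nat /= eR ltr_pdivrMr.
have [y []] : ball (L x) n.+1%:R^-1 `&` D !=set0.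
  apply: dD; last exact: ball_open.
  by exists (L x); apply: ballxx.
rewrite -ball_normE /= => yx Dy.
exists (u (y, n)); split; last by exists (y, n).
apply: xeO; rewrite /u; case: xgetP => [z _ /= yz|/(_ x)] /=; last first.
  by case; rewrite distrC.
rewrite -ball_normE /= -isoL; apply: lt_trans ne.
rewrite -(subrK y (L x)) -addrA (le_lt_trans (ler_normD _ _)) //.
by rewrite mulr_natl mulr2n ltrD.
Qed.

(** * Bounds for positive quadratic forms *)

Section PositiveOperators.
Variables (R : realType) (H : hilbertType R).

(** The two sides differ by the value of the form at [u - v]. *)
Lemma psd_parallelogram_le (D : {linear H -> H}) u v : psd D ->
  <| u + v, D (u + v) |> <= <| u, D u |> *+ 2 + <| v, D v |> *+ 2.
Proof.
move=> psdD; rewrite -subr_ge0.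
have -> : <| u, D u |> *+ 2 + <| v, D v |> *+ 2 - <| u + v, D (u + v) |>
    = <| u - v, D (u - v) |>.
  by rewrite (linearB D) (linearD D) !(hdotBr, hdotBl, hdotDr, hdotDl); ring.
exact: psdD.
Qed.

(** [C] depends on [x] alone and is chosen before [D] and [eps]; this uniformity is what allows the
    trace to tend to [1] later. *)
Lemma psd_le_on_span (A : set H) x : linear_span A x ->
  exists2 C : R, 0 <= C & forall (D : {linear H -> H}) (eps : R), psd D ->
    (forall g, A g -> <| g, D g |> <= eps%:C%C) ->
    <| x, D x |> <= (C * eps)%:C%C.
Proof.
move=> [n [c [v [Av ->]]]].
elim/big_ind: _ => [|y z [C C0 yC] [C' C'0 zC]|k _].
- by exists 0 => // D eps _ _; rewrite linear0 mul0r.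
- exists (2 * C + 2 * C'); first by rewrite addr_ge0 ?mulr_ge0.
  move=> D eps psdD Deps; apply: le_trans (psd_parallelogram_le _ _ psdD) _.
  rewrite mulrDl -!mulrA !mulr_natl rmorphD !rmorphMn.
  by rewrite lerD // lerMn2r /= ?yC ?zC.
(* The squared modulus of [c k], written as a real number. *)
- exists (complex.Re (c k) ^+ 2 + complex.Im (c k) ^+ 2).
    by rewrite addr_ge0 ?sqr_ge0.
  move=> D eps psdD Deps; rewrite (linearZ_LR D) hdotZr hdotZl mulrA -normCK.
  by rewrite rmorphM -add_Re2_Im2 ler_wpM2l ?Deps // add_Re2_Im2 exprn_ge0.
Qed.

End PositiveOperators.

(** * A product basis of the bipartite space *)

(** Since [f j] is a unit vector, [a] to [a (x) f_j] embeds [HA] isometrically into [HAB], which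
    makes [HA] separable and gives it a basis. *)
Lemma product_orthonormal_basis (R : realType) (HA HB HAB : hilbertType R)
    (tens : HA -> HB -> HAB) (J : choiceType) (f : J -> HB) :
  is_tensor_product tens -> separable_space HAB -> orthonormal_basis f ->
  exists (I : choiceType) (e : I -> HA),
    orthonormal_basis (fun p : I * J => tens (e p.1) (f p.2)).
Proof.
move=> tensP sepAB fB; have [[j]|J0] := pselect (inhabited J).
  have fj : `|f j| = 1.
    apply/eqP; rewrite -sqrp_eq1 // -hdot_norm.
    by rewrite (orthonormal_basis_dot fB) eqxx.
  have iso (a a' : HA) : `|tens a (f j) - tens a' (f j)| = `|a - a'|.
    by rewrite -tensBl // norm_tens // fj mulr1.
  have [I [e [eo ed]]] :=
    separable_orthonormal_basis (separable_isometry iso sepAB).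
  by exists I, e; exact: (orthonormal_basis_tens tensP fB eo (fun=> ed)).
(* [J] is empty, hence so is the product basis, whatever the family [e]. *)
pose e (i : void) : HA := match i with end.
have eo i i' : <| e i, e i' |> = (i == i')%:R by case: i.
exists void, e.
by apply: (orthonormal_basis_tens tensP fB eo) => j; case: J0.
Qed.

(** * Logarithm and limit estimates on reals *)

Lemma log2_ge0 (R : realType) (t : R) : 1 <= t -> (0 <= log2 t%:E)%E.
Proof.
move=> t1; apply: mule_ge0; first by rewrite lne_ge0 lee_fin.
by rewrite lee_fin invr_ge0 ln_ge0 // ler1n.
Qed.

Lemma log2_ltE (R : realType) (s t : R) :
  0 < s -> 0 < t -> (log2 s%:E < log2 t%:E)%E = (s < t).
Proof.
move=> s0 t0; rewrite /log2 !lne_EFin // -!EFinM lte_fin ltr_pM2r.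
  by rewrite ltr_ln.
by rewrite invr_gt0 ln_gt0 // ltr1n.
Qed.

Lemma ge0_approx (R : realType) (r C : R) : 0 <= C ->
  (forall d, 0 < d -> exists2 t, t < d & 0 <= r + C * t) -> 0 <= r.
Proof.
move=> C0 rC; rewrite leNgt; apply/negP => r0.
have C1 : 0 < C + 1 by rewrite ltr_wpDl.
(* If [r < 0], then [C * t >= - r > 0] forces [t > 0], which contradicts [(C + 1) * t < - r]. *)
have [|t td] := rC (- r / (C + 1)); first by rewrite divr_gt0 // oppr_gt0.
rewrite ltr_pdivlMr // in td.
nra.
Qed.

(** * Trace bounds for feasible operators *)

Section Feasible.
Context {R : realType} {HA HB HAB : hilbertType R}.
Variables (tens : HA -> HB -> HAB) (tensP : is_tensor_product tens).
Variables (J : choiceType) (f : J -> HB) (fB : orthonormal_basis f).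
Variables (I : choiceType) (e : I -> HA).
Let g (p : I * J) := tens (e p.1) (f p.2).
Hypothesis gB : orthonormal_basis g.

Lemma trace_diff_partial_transpose
    (rho S rhoT ST : {linear HAB -> HAB}) (t : R) :
  has_trace rho 1 -> has_trace S t%:C%C ->
  is_partial_transpose tens f rho rhoT -> is_partial_transpose tens f S ST ->
  op_le rhoT ST ->
  1 <= t /\ forall p, <| g p, ST (g p) - rhoT (g p) |> <= (t - 1)%:C%C.
Proof.
move=> trrho trS ptrho ptS leT.
(* [S - rho] itself need not be positive, but it shares its diagonal in the basis [g] with the
   positive operator [ST - rhoT]. *)
have D0 p : 0 <= (<| g p, S (g p) |> - <| g p, rho (g p) |>).
  rewrite -(partial_transpose_diag tensP fB (e p.1) p.2 ptS).
  rewrite -(partial_transpose_diag tensP fB (e p.1) p.2 ptrho) -hdotBr.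
  exact: leT.
have := has_sumB (trS _ _ gB) (trrho _ _ gB).
rewrite -(rmorph1 (real_complex R)) -rmorphB => D1.
split.
  (* The empty partial sum gives [0 <= t - 1]; the singleton of [p] below bounds the diagonal
     entry. *)
  rewrite -subr_ge0 -ler0c; apply: le_trans (has_sum_ge fset0 D0 D1).
  by rewrite big1 // => -[].
move=> p; rewrite hdotBr.
rewrite (partial_transpose_diag tensP fB (e p.1) p.2 ptS).
rewrite (partial_transpose_diag tensP fB (e p.1) p.2 ptrho).
apply: le_trans (has_sum_ge [fset p]%fset D0 D1).
rewrite -(big_seq_fsetE _ _ xpredT
  (fun p => <| g p, S (g p) |> - <| g p, rho (g p) |>)) /=.
by rewrite big_seq_fset1.
Qed.

End Feasible.

(** * The two directions for the entanglement measure *)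

Section KappaEntanglement.
Context {R : realType} {HA HB HAB : hilbertType R}.
Variables (tens : HA -> HB -> HAB) (tensP : is_tensor_product tens).
Variable sepAB : separable_space HAB.
Variables (J : choiceType) (f : J -> HB) (fB : orthonormal_basis f).
Variables (rho : {linear HAB -> HAB}) (rho_tr : has_trace rho 1).

Lemma kappa_feasible_trace_ge1 S (t : R) :
  kappa_feasible tens f rho S -> has_trace S t%:C%C -> 1 <= t.
Proof.
move=> [_ _ [rhoT [ST [ptrho ptS _ leT]]]] trS.
have [I [e gB]] := product_orthonormal_basis tensP sepAB fB.
by have [] := trace_diff_partial_transpose tensP fB gB rho_tr trS ptrho ptS leT.
Qed.

Lemma kappa_entanglement_ge0 : (0 <= kappa_entanglement tens f rho)%E.
Proof.
apply: le_ereal_inf_tmp => _ [S [t [feas trS ->]]].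
exact/log2_ge0/(kappa_feasible_trace_ge1 feas trS).
Qed.

(** Adding the two inequalities gives [2 U >= 0]. Then the form of [T] is a difference of
    nonnegative numbers, hence real, so that real estimates apply to it. *)
Lemma op_le_opp_psd (H : hilbertType R) (T U : {linear H -> H}) :
  op_le (fun x => - U x) T -> op_le T U ->
  psd U /\ forall x, <| x, T x |> \is Num.real.
Proof.
move=> leN le; have psdU : psd U.
  move=> x; have := addr_ge0 (leN x) (le x).
  rewrite -hdotDr opprK addrC subrKA -mulr2n -scaler_nat hdotZr.
  by rewrite pmulr_rge0 ?ltr0n.
split=> // x; have -> : <| x, T x |> = <| x, U x |> - <| x, U x - T x |>.
  by rewrite hdotBr subKr.
by rewrite rpredB ?ger0_real.
Qed.

Lemma kappa_entanglement0_ppt :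
  kappa_entanglement tens f rho = 0%E -> ppt tens f rho.
Proof.
move=> E0.
have near d : 0 < d -> exists S (t : R),
    [/\ kappa_feasible tens f rho S, has_trace S t%:C%C & t < 1 + d].
  move=> d0; have d1 : 0 < 1 + d by rewrite addr_gt0.
  have : (kappa_entanglement tens f rho < log2 (1 + d)%:E)%E.
    (* Rewrites [0] as the logarithm of [1], to compare it with that of [1 + d]. *)
    rewrite E0 -[ltLHS](mul0e (((ln 2)^-1)%:E)) -(lne1 R).
    by rewrite (log2_ltE (s := 1)) // ltrDl.
  move=> /ereal_inf_lt[_ [S [t [feas trS ->]]]].
  have t1 := kappa_feasible_trace_ge1 feas trS.
  by rewrite log2_ltE ?(lt_le_trans _ t1) // => td; exists S, t.
(* The value [d = 1] is arbitrary: one feasible operator fixes the transpose [rhoT] and shows that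
   its form is real. *)
have [S0 [_ [[_ _ [rhoT [ST0 [ptrho _ leN0 le0]]]] _ _]]] := near 1 ltr01.
have rhoT_real := (op_le_opp_psd leN0 le0).2.
exists rhoT => //.
have [I [e gB]] := product_orthonormal_basis tensP sepAB fB.
have crhoT : continuous rhoT by case: ptrho.
apply: (dense_sub_closed gB.2).
  apply: (@preimage_closed _ R[i]^o (fun x => <| x, rhoT x |>) _ _
    (@closed_num_ge R[i] 0)) => x _.
  by apply: continuous_hdot crhoT x => x; exact: cvg_id.
move=> x /psd_le_on_span[C C0 xC].
rewrite -(RRe_real (rhoT_real x)) ler0c.
apply: (ge0_approx C0) => d /near[S [t [feas trS td]]].
have [_ _ [rhoT' [ST [ptrho' ptS leN le]]]] := feas.
have [psdST _] := op_le_opp_psd leN le.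
(* The transpose of [rho] supplied with the present [S] agrees with the one fixed above. *)
have rhoTE y : rhoT' y = rhoT y.
  exact: (partial_transpose_unique tensP ptrho' ptrho).
have le' : op_le rhoT ST by move=> y; rewrite -rhoTE; exact: le.
have [t1 gt] :=
  trace_diff_partial_transpose tensP fB gB rho_tr trS ptrho ptS le'.
exists (t - 1); first by rewrite ltrBlDl.
rewrite -ler0c rmorphD /= (RRe_real (rhoT_real x)).
apply: (le_trans (psdST x)).
have -> : <| x, ST x |> = <| x, rhoT x |> + <| x, ST x - rhoT x |>.
  by rewrite -hdotDr subrKC.
rewrite lerD2l; apply: (xC (ST \- rhoT) (t - 1)) => //.
by move=> _ [p _ <-]; exact: gt.
Qed.

Lemma ppt_kappa_entanglement0 : trace_class rho -> psd rho ->
  ppt tens f rho -> kappa_entanglement tens f rho = 0%E.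
Proof.
move=> tc psdrho [rhoT ptrho psdT]; apply/eqP.
rewrite eq_le kappa_entanglement_ge0 andbT.
(* With [S = rho] the order conditions become [rhoT + rhoT >= 0] and [0 >= 0], and the logarithm of
   the trace [1] is [0]. *)
apply: ereal_inf_lbound; exists rho, 1; split.
- split=> //; exists rhoT, rhoT; split=> // x; last by rewrite subrr hdot0r.
  by rewrite opprK hdotDr addr_ge0.
- by rewrite rmorph1.
- by rewrite /log2 lne1 mul0e.
Qed.

End KappaEntanglement.

Theorem proposition10 (R : realType) (HA HB HAB : hilbertType R)
    (tens : HA -> HB -> HAB) (tensP : is_tensor_product tens)
    (sepAB : separable_space HAB)
    (J : choiceType) (f : J -> HB) (fB : orthonormal_basis f)
    (rho : {linear HAB -> HAB}) (rho_state : density_op rho) :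
  (0 <= kappa_entanglement tens f rho)%E /\
  (kappa_entanglement tens f rho = 0%E <-> ppt tens f rho).
Proof.
have [tc psdrho tr1] := rho_state; split; first exact: kappa_entanglement_ge0.
split; first exact: kappa_entanglement0_ppt.
exact: ppt_kappa_entanglement0.
Qed.
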